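(* In the setting described in the context (data $\Omega,\mathcal{U},f,\ell,C$), the following hold. (i) For every $\varepsilon\ge 0$ and $p_1,p_2\in\mathbb{N}$: if $p_1\le p_2$, then $\varepsilon\text{-}\operatorname{wargmin}_x(\mathcal{MP}_{p_1})\subseteq\varepsilon\text{-}\operatorname{wargmin}_x(\mathcal{MP}_{p_2})$. (ii) It holds that $$\bigcup_{p\in\mathbb{N}}\operatorname{wargmin}_x(\mathcal{MP}_p)\subseteq\operatorname{wargmin}(\mathcal{UP})=\bigcap_{\varepsilon>0}\bigcup_{p\in\mathbb{N}}\varepsilon\text{-}\operatorname{wargmin}_x(\mathcal{MP}_p).$$ Furthermore, if $f\big(\operatorname{wargmin}(\mathcal{UP})\times\mathcal{U}\big)$ is bounded, then for each $\varepsilon>0$ there exists $p\in\mathbb{N}$ such that $$\operatorname{wargmin}_x(\mathcal{MP}_p)\subseteq\operatorname{wargmin}(\mathcal{UP})\subseteq\varepsilon\text{-}\operatorname{wargmin}_x(\mathcal{MP}_p).$$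
   Context: Conventions: $\mathbb{N}=\{1,2,\dots\}$, $[p]=\{1,\dots,p\}$; inequalities $\le$, $<$ between vectors are componentwise; $e$ is the all-ones vector of appropriate dimension; $\mathbb{R}^m_+$ is the nonnegative orthant; $\operatorname{Int}$, $\operatorname{cl}$, $(\cdot)^c$ are interior, closure, complement in $\mathbb{R}^m$. A cone $C$ (i.e. $\lambda\ge0$, $c\in C$ imply $\lambda c\in C$) is pointed if $C\cap(-C)=\{0\}$ and solid if $\operatorname{Int}C\neq\emptyset$. Setting: $\Omega\subseteq\mathbb{R}^n$ and $\mathcal{U}\subseteq\mathbb{R}^k$ are nonempty and closed, $\mathcal{U}$ is compact, and $f:\Omega\times\mathcal{U}\to\mathbb{R}^m$ is continuous. $\ell\in\mathbb{R}^m$ is a vector and $C\subseteq(\operatorname{Int}\mathbb{R}^m_+)\cup\{0\}$ is a closed, convex, pointed, solid cone such that $f(\Omega\times\mathcal{U})\subseteq\{\ell\}+\operatorname{Int}C$. For $x\in\Omega$ put $F_{\mathcal{U}}(x):=\{f(x,u)\mid u\in\mathcal{U}\}$. The set $\operatorname{wargmin}(\mathcal{UP})$ of robust weakly efficient solutions consists of all $\bar x\in\Omega$ for which there is no $x\in\Omega$ with $F_{\mathcal{U}}(x)\subseteq F_{\mathcal{U}}(\bar x)-\operatorname{Int}\mathbb{R}^m_+$. Let $\mathrm{ub}(x):=\big(\sup_{u\in\mathcal{U}}f_1(x,u),\dots,\sup_{u\in\mathcal{U}}f_m(x,u)\big)^\top+e$, $[y^1,y^2]_C:=(\{y^1\}+C)\cap(\{y^2\}-\mathbb{R}^m_+)$,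 and $F(x):=\operatorname{cl}\big((F_{\mathcal{U}}(x)-\mathbb{R}^m_+)^c\big)\cap[\ell,\mathrm{ub}(x)]_C$. For $p\in\mathbb{N}$, $(\mathcal{MP}_p)$ is the multiobjective problem of minimizing $(y^1,\dots,y^p)\in\mathbb{R}^{mp}$ over all $(x,y^1,\dots,y^p)\in\mathbb{R}^n\times(\mathbb{R}^m)^p$ with $x\in\Omega$, $y^i-\ell\in C$ for all $i\in[p]$, and $\min_{j\in[m]}\{f_j(x,u)-y^i_j\}\le 0$ for all $u\in\mathcal{U}$, $i\in[p]$. For $\varepsilon\ge0$, a feasible $(\bar x,\bar y^1,\dots,\bar y^p)$ is $\varepsilon$-weakly efficient for $(\mathcal{MP}_p)$ if there is no feasible $(x,y^1,\dots,y^p)$ with $y^i<\bar y^i-\varepsilon e$ for all $i\in[p]$; the set of these is $\varepsilon\text{-}\operatorname{wargmin}(\mathcal{MP}_p)$. Its projection is $\varepsilon\text{-}\operatorname{wargmin}_x(\mathcal{MP}_p):=\{x'\in\mathbb{R}^n\mid\exists\,y^1,\dots,y^p\in F(x'):(x',y^1,\dots,y^p)\in\varepsilon\text{-}\operatorname{wargmin}(\mathcal{MP}_p)\}$, and $\operatorname{wargmin}_x(\mathcal{MP}_p)$ is the case $\varepsilon=0$. *)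

(* Defs.v *)
From HB Require Import structures.
From mathcomp Require Import all_boot all_order all_algebra.
From mathcomp Require Import all_classical all_reals all_analysis.

Set Implicit Arguments.
Unset Strict Implicit.
Unset Printing Implicit Defensive.

Import Order.TTheory GRing.Theory Num.Theory.
Import numFieldNormedType.Exports.

Local Open Scope classical_set_scope.
Local Open Scope ring_scope.

(* R^d is 'rV[R]_d; the objective space is 'rV[R]_m.+1, since the constraint
   of MP_p takes a minimum over its (hence nonempty) set of coordinates. *)

Section Vectors.
Context {R : realType}.

Definition ones {d : nat} : 'rV[R]_d := const_mx 1.

Definition ltv {d : nat} (y z : 'rV[R]_d) : Prop := forall j, y 0 j < z 0 j.

Definition vmin {m : nat} (v : 'rV[R]_m.+1) : R :=
  \big[Order.min/v 0 ord0]_(j < m.+1) v 0 j.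

Definition orthant {d : nat} : set 'rV[R]_d := [set y | forall j, 0 <= y 0 j].

Definition set_add {d : nat} (A B : set 'rV[R]_d) : set 'rV[R]_d :=
  [set a + b | a in A & b in B].

Definition set_sub {d : nat} (A B : set 'rV[R]_d) : set 'rV[R]_d :=
  [set a - b | a in A & b in B].

Definition is_cone {d : nat} (C : set 'rV[R]_d) : Prop :=
  forall (lambda : R) c, 0 <= lambda -> C c -> C (lambda *: c).

Definition pointed_cone {d : nat} (C : set 'rV[R]_d) : Prop :=
  C `&` [set - c | c in C] = [set 0].

Definition solid {d : nat} (C : set 'rV[R]_d) : Prop := interior C !=set0.

End Vectors.

Section Problems.
Context {R : realType} {n k m : nat}.
Variables (Omega : set 'rV[R]_n) (U : set 'rV[R]_k).
Variable f : 'rV[R]_n * 'rV[R]_k -> 'rV[R]_m.+1.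
Variables (l : 'rV[R]_m.+1) (C : set 'rV[R]_m.+1).

Definition FU (x : 'rV[R]_n) : set 'rV[R]_m.+1 := [set f (x, u) | u in U].

Definition wargmin_UP : set 'rV[R]_n :=
  [set xbar | Omega xbar /\
    ~ exists2 x, Omega x & FU x `<=` set_sub (FU xbar) (interior orthant)].

Definition ub (x : 'rV[R]_n) : 'rV[R]_m.+1 :=
  (\row_j sup [set f (x, u) 0 j | u in U]) + ones.

Definition boxC (y1 y2 : 'rV[R]_m.+1) : set 'rV[R]_m.+1 :=
  set_add [set y1] C `&` set_sub [set y2] orthant.

Definition Fbox (x : 'rV[R]_n) : set 'rV[R]_m.+1 :=
  closure (~` set_sub (FU x) orthant) `&` boxC l (ub x).

Definition MP_feasible (p : nat) : set ('rV[R]_n * ('I_p -> 'rV[R]_m.+1)) :=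
  [set z | [/\ Omega z.1,
    forall i, C (z.2 i - l) &
    forall u i, U u -> vmin (f (z.1, u) - z.2 i) <= 0]].

Definition eps_wargmin_MP (eps : R) (p : nat) :
    set ('rV[R]_n * ('I_p -> 'rV[R]_m.+1)) :=
  [set zbar | MP_feasible zbar /\
    ~ exists2 z, MP_feasible z &
      forall i, ltv (z.2 i) (zbar.2 i - eps *: ones)].

Definition eps_wargminx_MP (eps : R) (p : nat) : set 'rV[R]_n :=
  [set x' | exists2 y : 'I_p -> 'rV[R]_m.+1,
    forall i, Fbox x' (y i) & eps_wargmin_MP eps (x', y)].

Definition wargminx_MP (p : nat) : set 'rV[R]_n := eps_wargminx_MP 0 p.

End Problems.

(* Main.v *)
Require Import Defs.
From HB Require Import structures.
From mathcomp Require Import all_boot all_order all_algebra.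
From mathcomp Require Import all_classical all_reals all_analysis.
From mathcomp Require Import lra.

Import Order.TTheory GRing.Theory Num.Theory.
Import numFieldNormedType.Exports.

Local Open Scope classical_set_scope.
Local Open Scope ring_scope.

(** Call an outcome [y] beaten at [x] when [y < f (x, u)] in every coordinate
    for some scenario [u]. The beaten outcomes form the open set
    [FU x - Int R^m_+], and its complement is both the closure in the
    definition of [Fbox] and the set cut out by the scenario constraint of
    (MP_p). So [x] is robust weakly efficient iff every admissible [x'] has an
    outcome [f (x', u)] not beaten at [x], and a feasible point of (MP_p) is an
    admissible [x] with [p] points of [l + C] that are not beaten at [x].

    Points that are not robust are not [eps]-efficient for small [eps]
    ([dominated_not_eps_efficient]). If all outcomes of [x'] are beaten at
    [x], then by compactness of [FU x'] they stay so after a shift by some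
    [d > 0] in every coordinate. Let the [y i] be unbeaten
    at [x]; moving each of them towards [l] by at most [d] per coordinate gives
    points that are still in [l + C] and are unbeaten at [x'], so [(x', z)]
    improves [(x, y)]. Because [C] minus the origin lies in the open orthant
    and the [y i] stay away from [l], this improvement is at least some
    [e0 > 0] in each coordinate, where [e0] depends neither on [p] nor on the
    [y i]. With [eps = 0] this gives the inclusion of the exact solutions of
    (MP_p) in the robust ones, and with [eps < e0] it gives the inclusion of
    the intersection over [eps].

    Conversely, let [x] be robust ([robust_eps_efficient]). Cut a box
    containing [Fbox x] into cells of side [eps] and choose one [y i] of
    [Fbox x] in every cell that meets it. If [(x', z)] improved all the [y i]
    by more than [eps], take an outcome [f (x', u)] not beaten at [x]; some
    point [w] of [Fbox x] lies below it ([Fbox_below]), the [y i] in the cell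
    of [w] is at most [w + eps e], so [z i < f (x', u)] is beaten at [x'], a
    contradiction. The number [p] of cells depends only on the box, hence a
    single [p] serves all robust [x] when their outcomes are bounded. *)

(** * Vectors, cones and grids *)

Section Vectors.
Set Implicit Arguments.
Unset Strict Implicit.
Context {R : realType}.

Lemma vmin_le0P (m : nat) (v : 'rV[R]_m.+1) :
  vmin v <= 0 <-> exists j, v 0 j <= 0.
Proof.
split=> [|[j vj]]; last exact: bigmin_inf vj.
rewrite /vmin; elim/big_ind: _ => [v0|a b ha hb|j _ vj].
- by exists ord0.
- by rewrite ge_min => /orP[].
- by exists j.
Qed.

Lemma coord_le_norm (m : nat) (v : 'rV[R]_m) j : `|v 0 j| <= `|v|.
Proof.
by rewrite [leRHS]mx_normrE (le_bigmax _ (fun ij => `|v ij.1 ij.2|) (0, j)).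
Qed.

Lemma pos_lower_bound (I : finType) (F : I -> R) :
  (forall i, 0 < F i) -> exists2 t, 0 < t & forall i, t < F i.
Proof.
move=> F0; have : \forall t \near 0^'+, 0 < t /\ forall i, t < F i.
  apply: filterI; first exact: nbhs_right_gt.
  have HF : Filter (0^'+ : set_system R) by typeclasses eauto.
  apply: (@filter_forall _ _ (fun i t => t < F i) _ HF) => i.
  exact: nbhs_right_lt.
by move=> /filter_ex[t [t0 tF]]; exists t.
Qed.

Lemma near_coords (m : nat) (a : 'rV[R]_m) (P : 'I_m -> set R) :
  (forall j, nbhs (a 0 j) (P j)) ->
  nbhs a [set y : 'rV[R]_m | forall j, P j (y 0 j)].
Proof.
move=> aP; have HF : Filter (nbhs a) by typeclasses eauto.
have := @filter_forall _ _ (fun j (y : 'rV[R]_m) => P j (y 0 j)) (nbhs a) HF.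
apply=> j.
by have /(_ _ (aP j)) := @coord_continuous R 1 m 0 j a; apply.
Qed.

Lemma interior_orthantP (m : nat) (y : 'rV[R]_m) :
  interior orthant y <-> ltv 0 y.
Proof.
split=> [/nbhs_ballP [r /= r0 yr] j|y0].
  have : orthant (y - (r / 2) *: ones).
    apply: yr; split => // i i'; rewrite /ball /= !mxE mulr1.
    by rewrite ord1 opprB addrC subrK gtr0_norm; lra.
  move=> /(_ j); rewrite !mxE mulr1 subr_ge0; apply: lt_le_trans.
  by rewrite divr_gt0.
have : nbhs y [set z : 'rV[R]_m | forall j, 0 < z 0 j].
  apply: (near_coords (P := fun _ => [set t | 0 < t])) => j.
  by have := y0 j; rewrite mxE => /lt_nbhsr.
by apply: filterS => z z0 j; exact: ltW.
Qed.

(** On the part of [C] in the unit sphere, which is compact, all coordinates are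
    positive, hence bounded below by a common constant; homogeneity carries the
    bound to the whole cone. *)
Lemma cone_coord_ratio (m : nat) (C : set 'rV[R]_m) :
  closed C -> is_cone C -> C `<=` interior orthant `|` [set 0] ->
  exists2 kappa : R, 0 < kappa &
    forall c, C c -> forall i j, kappa * c 0 i <= c 0 j.
Proof.
move=> Ccl Ccone Cpos.
have cptK : compact (C `&` [set c | `|c| = 1]).
  apply: bounded_closed_compact.
    by exists 1; split => // M M1 c [_ /= ->]; exact: ltW.
  apply: closedI => //.
  apply: (@preimage_closed _ _ (fun c : 'rV[R]_m => `|c|) [set 1]).
    by move=> c _; exact: norm_continuous.
  exact: closed_eq.
have /compact_near_coveringP/(_ R (at_right 0)
  (fun t c => forall j, t <= c 0 j) _) := cptK.
case=> [c [Cc c1]|].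
  case: (Cpos c Cc) => [/interior_orthantP c0|c0]; last first.
    by move: c1; rewrite c0 /= normr0 => /esym/eqP; rewrite oner_eq0.
  have [t t0 tc] : exists2 t, 0 < t & forall j, t < c 0 j.
    by apply: pos_lower_bound => j; have := c0 j; rewrite mxE.
  exists ([set c' : 'rV[R]_m | forall j, t < c' 0 j],
          [set s : R | s < t]) => /=.
    split; last exact: nbhs_right_lt.
    apply: (near_coords (P := fun _ => [set s | t < s])) => j.
    exact: lt_nbhsr.
  by move=> [c' s] /= [tc' st] j; apply/ltW/(lt_trans st).
move=> e /= e0 Hk.
have {}Hk : forall c, C c -> `|c| = 1 -> forall j, e / 2 <= c 0 j.
  move=> c Cc c1; apply: (Hk (e / 2)) => //=; last lra.
  by rewrite sub0r normrN gtr0_norm; lra.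
exists (e / 2) => [|c Cc i j]; first lra.
have [->|c0] := eqVneq c 0; first by rewrite !mxE mulr0.
have nc0 : 0 < `|c| by rewrite normr_gt0.
have Cu : C (`|c|^-1 *: c) by apply: Ccone; rewrite ?invr_ge0.
have nu : `|(`|c|^-1 *: c)| = 1 by rewrite normrZ normfV normr_id mulVf ?gt_eqF.
have := Hk _ Cu nu j; rewrite mxE [`|c|^-1 * _]mulrC ler_pdivlMr//.
apply: le_trans; rewrite ler_pM2l ?divr_gt0//.
exact: le_trans (ler_norm _) (coord_le_norm _ _).
Qed.

(** [c] sends a vector to the cell of side [eps], in a grid with corner [l],
    that contains it. Finitely many labels are enough, because only vectors of
    the box between [l] and [M] are compared. *)
Lemma finite_grid (m : nat) (l M : 'rV[R]_m) (eps : R) : 0 < eps ->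
  exists (T : finType) (c : 'rV[R]_m -> T), forall y y' : 'rV[R]_m,
    (forall j, l 0 j <= y 0 j <= M 0 j) ->
    (forall j, l 0 j <= y' 0 j <= M 0 j) ->
    c y = c y' -> forall j, y 0 j <= y' 0 j + eps.
Proof.
move=> eps0; pose cell (y : 'rV[R]_m) j := Num.truncn ((y 0 j - l 0 j) / eps).
pose N := Num.truncn (`|M - l| / eps).
exists {ffun 'I_m -> 'I_N.+1}, (fun y => [ffun j => inord (cell y j)]).
have cellN (y : 'rV[R]_m) j :
    (forall j, l 0 j <= y 0 j <= M 0 j) -> (cell y j < N.+1)%N.
  move=> yM; rewrite ltnS; apply: le_truncn; rewrite ler_pM2r ?invr_gt0//.
  apply: le_trans (coord_le_norm (M - l) j); apply: le_trans (ler_norm _).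
  by rewrite !mxE lerD2r; have /andP[] := yM j.
move=> y y' yM yM' /ffunP cE j; have := cE j; rewrite !ffunE.
move=> /(congr1 (@nat_of_ord _)); rewrite !inordK ?cellN// => {}cE.
have /truncn_itv/andP[_] : 0 <= (y 0 j - l 0 j) / eps.
  by apply: divr_ge0 (ltW eps0); rewrite subr_ge0; have /andP[] := yM j.
have /truncn_itv/andP[+ _] : 0 <= (y' 0 j - l 0 j) / eps.
  by apply: divr_ge0 (ltW eps0); rewrite subr_ge0; have /andP[] := yM' j.
rewrite -/(cell y j) -/(cell y' j) cE ler_pdivlMr// ltr_pdivrMr// -natr1; lra.
Qed.

End Vectors.

(** * The two problems in terms of beaten outcomes *)

Section Problems.
Set Implicit Arguments.
Unset Strict Implicit.
Context {R : realType} {n k m : nat}.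
Variables (Omega : set 'rV[R]_n) (U : set 'rV[R]_k).
Variable f : 'rV[R]_n * 'rV[R]_k -> 'rV[R]_m.+1.
Variables (l : 'rV[R]_m.+1) (C : set 'rV[R]_m.+1).

Definition beaten (x : 'rV[R]_n) : set 'rV[R]_m.+1 :=
  [set y | exists2 u, U u & ltv y (f (x, u))].

Lemma set_sub_interior_orthant x :
  set_sub (FU U f x) (interior orthant) = beaten x.
Proof.
apply/seteqP; split=> y.
  move=> [_ [u Uu <-]] [b /interior_orthantP b0 <-].
  by exists u => // j; have := b0 j; rewrite !mxE gtrBl.
move=> [u Uu yf]; exists (f (x, u)); first by exists u.
exists (f (x, u) - y); last by rewrite opprB addrC subrK.
by apply/interior_orthantP => j; rewrite !mxE subr_gt0; exact: yf.
Qed.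

Lemma not_beatenP x y :
  ~ beaten x y <-> forall u, U u -> exists j, f (x, u) 0 j <= y 0 j.
Proof.
split=> [nb u Uu|H [u Uu yf]].
  apply: contrapT => nj; apply: nb; exists u => // j.
  by rewrite ltNge; apply/negP => fy; apply: nj; exists j.
by have [j] := H u Uu; rewrite leNgt yf.
Qed.

Lemma not_beaten_le x (y z : 'rV[R]_m.+1) :
  ~ beaten x y -> (forall j, y 0 j <= z 0 j) -> ~ beaten x z.
Proof.
move=> ny yz [u Uu zf]; apply: ny; exists u => // j.
exact: le_lt_trans (yz j) (zf j).
Qed.

(** The beaten outcomes are the interior of [FU x - R^m_+]: they form an open
    set, and an unbeaten [y] is the limit of the [y + r e], [r > 0], none of
    which is below an outcome of [x]. *)
Lemma closure_not_below x :
  closure (~` set_sub (FU U f x) orthant) = ~` beaten x.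
Proof.
have subE y : set_sub (FU U f x) orthant y <->
    exists2 u, U u & forall j, y 0 j <= f (x, u) 0 j.
  split=> [[_ [u Uu <-]] [b b0 <-]|[u Uu yf]].
    by exists u => // j; have := b0 j; rewrite !mxE gerBl.
  exists (f (x, u)); first by exists u.
  exists (f (x, u) - y); last by rewrite opprB addrC subrK.
  by move=> j; rewrite !mxE subr_ge0.
apply/seteqP; split=> y.
  move=> cy [u Uu yf].
  have /cy [z [nz zf]] :
      nbhs y [set z : 'rV[R]_m.+1 | forall j, z 0 j < f (x, u) 0 j].
    apply: (near_coords (P := fun j => [set t | t < f (x, u) 0 j])) => j.
    exact: lt_nbhsl.
  by apply: nz; apply/subE; exists u => // j; exact/ltW/zf.
move=> ny B /nbhs_ballP [r /= r0 rB].
exists (y + (r / 2) *: ones); split; last first.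
  apply: rB; split => // i i'; rewrite /ball /= !mxE mulr1 ord1.
  by rewrite opprD addrA subrr sub0r normrN gtr0_norm; lra.
move=> /subE [u Uu yf]; apply: ny; exists u => // j.
by have := yf j; rewrite !mxE mulr1; lra.
Qed.

Lemma FboxP x y : Fbox U f l C x y <->
  [/\ ~ beaten x y, C (y - l) & forall j, y 0 j <= ub U f x 0 j].
Proof.
rewrite /Fbox closure_not_below; split.
  move=> [ny [[_ -> [c Cc yE]] [_ -> [b b0 ye]]]]; split => //.
    by rewrite -yE addrC addKr.
  by move=> j; rewrite -ye; have := b0 j; rewrite !mxE gerBl.
move=> [ny Cy yu]; split=> //; split.
  by exists l => //; exists (y - l) => //; rewrite addrC subrK.
exists (ub U f x) => //.
exists (ub U f x - y); last by rewrite opprB addrC subrK.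
by move=> j; have := yu j; rewrite !mxE subr_ge0.
Qed.

Lemma MP_feasibleP p x (y : 'I_p -> 'rV[R]_m.+1) :
  MP_feasible Omega U f l C (x, y) <->
  [/\ Omega x, forall i, C (y i - l) & forall i, ~ beaten x (y i)].
Proof.
split=> [[/= Ox Cy fy]|[Ox Cy fy]]; split => //.
  move=> i; apply/not_beatenP => u Uu.
  by have /vmin_le0P[j] := fy u i Uu; rewrite !mxE subr_le0; exists j.
move=> u i Uu; apply/vmin_le0P => /=.
by have /not_beatenP/(_ u Uu)[j] := fy i; exists j; rewrite !mxE subr_le0.
Qed.

Lemma wargmin_UPP x : wargmin_UP Omega U f x <->
  Omega x /\ forall x', Omega x' -> exists2 u, U u & ~ beaten x (f (x', u)).
Proof.
rewrite /wargmin_UP /= set_sub_interior_orthant; split=> -[Ox H]; split=> //.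
  move=> x' Ox'; apply: contrapT => nu; apply: H; exists x' => // _ [u Uu <-].
  by apply: contrapT => nb; apply: nu; exists u.
by move=> [x' /H [u Uu nb] sub]; apply: nb; apply: sub; exists u.
Qed.

Lemma eps_wargminxP eps p x : eps_wargminx_MP Omega U f l C eps p x <->
  exists2 y : 'I_p -> 'rV[R]_m.+1, (forall i, Fbox U f l C x (y i)) &
    Omega x /\ ~ exists x' (z : 'I_p -> 'rV[R]_m.+1),
      [/\ Omega x', forall i, C (z i - l), forall i, ~ beaten x' (z i) &
        forall i j, z i 0 j < y i 0 j - eps].
Proof.
have E y j : (y - eps *: ones : 'rV[R]_m.+1) 0 j = y 0 j - eps.
  by rewrite !mxE mulr1.
split=> -[y Fy].
  move=> [/MP_feasibleP[Ox _ _] nd]; exists y => //; split => //.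
  move=> [x' [z [Ox' Cz zb zy]]]; apply: nd; exists (x', z).
    exact/MP_feasibleP.
  by move=> i j; rewrite /= E.
move=> [Ox nd]; exists y => //; split.
  by apply/MP_feasibleP; split => // i; have /FboxP[] := Fy i.
move=> [[x' z] /MP_feasibleP [Ox' Cz zb] zy]; apply: nd.
exists x', z; split => //.
by move=> i j; have := zy i j; rewrite /= E.
Qed.

(** A tuple lengthened by repetitions of one entry is still feasible, and what
    improves it also improves, after restriction, the original tuple. *)
Lemma eps_wargminx_widen eps p1 p2 : (0 < p1)%N -> (p1 <= p2)%N ->
  eps_wargminx_MP Omega U f l C eps p1 `<=`
  eps_wargminx_MP Omega U f l C eps p2.
Proof.
move=> p10 p12 x /eps_wargminxP[y Fy [Ox nd]].
(* the indices from [p1] on all stand for the point of index 0 *)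
pose g (i : 'I_p2) : 'I_p1 := insubd (Ordinal p10) (val i).
apply/eps_wargminxP; exists (y \o g); first by move=> i; exact: Fy.
split=> // -[x' [z [Ox' Cz nz zy]]]; apply: nd.
exists x', (z \o widen_ord p12); split => // [i|i|i j] /=; first exact: Cz.
  exact: nz.
by have := zy (widen_ord p12 i) j; rewrite /= /g /= valKd.
Qed.

(** * Dominated points *)

Lemma FU_compact x : Omega x -> compact U ->
  {within Omega `*` U, continuous f} -> compact (FU U f x).
Proof.
move=> Ox cU fc.
have -> : FU U f x = f @` ([set x] `*` U).
  apply/seteqP; split=> [_ [u Uu <-]|_ [[_ u] [/= -> Uu] <-]]; last by exists u.
  by exists (x, u).
apply: continuous_compact; last first.
  by apply: compact_setX => //; exact: compact_set1.
by apply: continuous_subspaceW fc => -[_ u] [/= -> Uu].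
Qed.

Lemma ub_ge x u j : compact (FU U f x) -> U u -> f (x, u) 0 j <= ub U f x 0 j.
Proof.
move=> /compact_bounded [M [_ HM]] Uu; rewrite !mxE.
apply: (@le_trans _ _ (sup [set f (x, u) 0 j | u in U])); last by rewrite lerDl.
apply: ub_le_sup; last by exists u.
exists (M + 1) => _ [v Uv <-].
apply: le_trans (ler_norm _) _; apply: le_trans (coord_le_norm _ _) _.
by apply: HM; [rewrite ltrDl|exists v].
Qed.

(** Each point of [K] can be shifted a little, uniformly on a neighbourhood of
    it, without leaving the open set [beaten x]; compactness makes the shift
    uniform on [K]. *)
Lemma beaten_slack (K : set 'rV[R]_m.+1) x : compact K -> K `<=` beaten x ->
  exists2 d, 0 < d & forall y, K y -> beaten x (y + d *: ones).
Proof.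
move=> /compact_near_coveringP/(_ R (at_right 0)
  (fun d y => beaten x (y + d *: ones)) _) + KD.
case=> [y /KD [u Uu yf]|].
  have [t t0 tf] : exists2 t, 0 < t & forall j, t < (f (x, u) 0 j - y 0 j) / 2.
    by apply: pos_lower_bound => j; rewrite divr_gt0// subr_gt0; exact: yf.
  exists ([set z : 'rV[R]_m.+1 | forall j, z 0 j < y 0 j + t],
          [set d : R | d < t]) => /=.
    split; last exact: nbhs_right_lt.
    apply: (near_coords (P := fun j => [set s | s < y 0 j + t])) => j.
    by apply: lt_nbhsl; rewrite ltrDl.
  move=> [z d] /= [zy dt]; exists u => // j; rewrite !mxE mulr1.
  by have := zy j; have := tf j; lra.
move=> e /= e0 He; exists (e / 2); first lra.
by move=> y Ky; apply: He Ky; rewrite /= ?sub0r ?normrN ?gtr0_norm; lra.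
Qed.

Section Cone.
Hypothesis U_neq0 : U !=set0.
Hypothesis C_orthant : C `<=` interior orthant `|` [set 0].
Hypothesis C_cone : is_cone C.
Hypothesis l_lt : forall x u, Omega x -> U u -> ltv l (f (x, u)).

Lemma C_ge0 y j : C (y - l) -> l 0 j <= y 0 j.
Proof.
rewrite -subr_ge0 => /C_orthant[/interior_orthantP/(_ j)|/matrixP/(_ 0 j)].
  by rewrite !mxE => /ltW.
by rewrite !mxE => ->.
Qed.

(** The threshold [e0] is independent of [p], which is what excludes a dominated
    [x] from a union over all [p]. Moving along the segment to [l], rather than
    along the vector of ones, keeps the points in [l + C]. *)
Lemma dominated_not_eps_efficient x x' :
  closed C -> compact (FU U f x') -> Omega x -> Omega x' ->
  FU U f x' `<=` beaten x ->
  exists2 e0, 0 < e0 & forall p eps, eps < e0 ->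
    ~ eps_wargminx_MP Omega U f l C eps p x.
Proof.
move=> Ccl cF Ox Ox' dom.
have [kappa kappa0 Ck] := cone_coord_ratio Ccl C_cone C_orthant.
have [u0 Uu0] := U_neq0.
have [eta eta0 f_eta] : exists2 t, 0 < t & forall j, t < f (x, u0) 0 j - l 0 j.
  by apply: pos_lower_bound => j; rewrite subr_gt0; exact: l_lt.
have [d d0 slack] := beaten_slack cF dom.
pose B := `|ub U f x - l| + 1.
have B0 : 0 < B by rewrite ltr_wpDl.
(* the largest fraction of the segment to [l] that moves no coordinate by more
   than [d] *)
pose t := Num.min 1 (d / B).
have t0 : 0 < t by rewrite lt_min ltr01 divr_gt0.
have t1 : t <= 1 by rewrite ge_min lexx.
have tB : t * B <= d by rewrite -ler_pdivlMr// ge_min lexx orbT.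
exists (t * (kappa * eta)); first by rewrite !mulr_gt0.
move=> p eps eps_lt /eps_wargminxP[y Fy [_ nd]]; apply: nd.
(* being unbeaten in the single scenario [u0] keeps one coordinate of [y i] away
   from [l], and the cone transfers this to all coordinates *)
have ylow i j : kappa * eta <= y i 0 j - l 0 j.
  have /FboxP[/not_beatenP/(_ u0 Uu0)[j0 fy] Cy _] := Fy i.
  have := Ck _ Cy j0 j; rewrite !mxE; apply: le_trans.
  by rewrite ler_pM2l//; have := f_eta j0; lra.
have yup i j : y i 0 j - l 0 j <= B.
  have /FboxP[_ _ yu] := Fy i.
  have := le_trans (ler_norm _) (coord_le_norm (ub U f x - l) j).
  rewrite [(_ - l) 0 j]mxE [(- l) 0 j]mxE /B; have := yu j; lra.
exists x', (fun i => y i - t *: (y i - l)); split => // [i|i|i j].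
- have -> : y i - t *: (y i - l) - l = (1 - t) *: (y i - l).
    by rewrite scalerBl scale1r addrAC.
  by apply: C_cone; [rewrite subr_ge0|have /FboxP[] := Fy i].
- move=> [u Uu zf]; have /FboxP[ny _ _] := Fy i; apply: ny.
  have [|v Uv fv] := slack (f (x', u)); first by exists u.
  exists v => // j; apply: le_lt_trans (fv j); have := zf j; rewrite !mxE mulr1.
  have : t * (y i 0 j - l 0 j) <= t * B by rewrite ler_pM2l.
  lra.
- rewrite !mxE.
  have : t * (kappa * eta) <= t * (y i 0 j - l 0 j) by rewrite ler_pM2l.
  lra.
Qed.

(** * Robust points *)

(** Go from [w] down the segment to [l], which is itself beaten, as far as the
    points remain unbeaten. The last unbeaten point is a limit of beaten ones,
    hence below the coordinatewise supremum of the outcomes of [x]. *)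
Lemma Fbox_below x w : compact (FU U f x) -> Omega x ->
  C (w - l) -> ltv l w -> ~ beaten x w ->
  exists2 y, Fbox U f l C x y & forall j, y 0 j <= w 0 j.
Proof.
move=> cF Ox Cw lw nw.
have lw' j : 0 < w 0 j - l 0 j by rewrite subr_gt0; exact: lw.
pose S := [set s : R | beaten x (l + s *: (w - l))].
have S0 : S 0.
  by have [u Uu] := U_neq0; exists u => //; rewrite scale0r addr0; exact: l_lt.
have S1 : ubound S 1.
  move=> s Ss; rewrite leNgt; apply/negP => s1.
  apply: (not_beaten_le nw _ Ss) => j; rewrite !mxE.
  have : 0 < (s - 1) * (w 0 j - l 0 j) by rewrite mulr_gt0// subr_gt0.
  lra.
have bS : has_ubound S by exists 1.
have s0 : 0 <= sup S by exact: ub_le_sup.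
have s1 : sup S <= 1 by apply: ge_sup => //; exists 0.
exists (l + sup S *: (w - l)); last first.
  move=> j; rewrite !mxE.
  have : 0 <= (1 - sup S) * (w 0 j - l 0 j).
    by rewrite mulr_ge0 ?subr_ge0// -subr_ge0 ltW.
  lra.
apply/FboxP; split.
- move=> [u Uu sf].
  have [t t0 tf] : exists2 t, 0 < t & forall j,
      t < (f (x, u) 0 j - (l + sup S *: (w - l)) 0 j) / (w 0 j - l 0 j).
    by apply: pos_lower_bound => j; rewrite divr_gt0// subr_gt0; exact: sf.
  have : S (sup S + t).
    exists u => // j; have := tf j; rewrite ltr_pdivlMr//.
    by rewrite !mxE; lra.
  by move=> /(ub_le_sup bS); rewrite gerDl leNgt t0.
- by rewrite addrAC subrr add0r; exact: C_cone.
- move=> j; rewrite !mxE -lerBrDl -ler_pdivlMr; last exact: lw'.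
  apply: ge_sup; first by exists 0.
  move=> s [u Uu sf]; rewrite ler_pdivlMr; last exact: lw'.
  have := sf j; have := ub_ge j cF Uu; rewrite !mxE; lra.
Qed.

(** The number [p] of grid cells depends only on the box from [l] to [M], so it
    serves all robust [x] whose outcomes stay below [M]. *)
Lemma robust_eps_efficient (M : 'rV[R]_m.+1) eps : 0 < eps ->
  (forall x u, Omega x -> U u -> C (f (x, u) - l)) ->
  (forall x, Omega x -> compact (FU U f x)) ->
  exists2 p, (0 < p)%N & forall x, wargmin_UP Omega U f x ->
    (forall j, ub U f x 0 j <= M 0 j) -> eps_wargminx_MP Omega U f l C eps p x.
Proof.
move=> eps0 Cf cF; have [T [c cP]] := finite_grid l M eps0.
exists #|T|; first by apply/card_gt0P; exists (c l).
move=> x /wargmin_UPP [Ox dom] uM.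
have FM y j : Fbox U f l C x y -> l 0 j <= y 0 j <= M 0 j.
  by move=> /FboxP[_ Cy yu]; rewrite C_ge0//=; exact: le_trans (yu j) (uM j).
have below x' : Omega x' -> exists2 u, U u &
    exists2 y, Fbox U f l C x y & forall j, y 0 j <= f (x', u) 0 j.
  move=> Ox'; have [u Uu nb] := dom x' Ox'; exists u => //.
  by apply: Fbox_below => //; [exact: cF|exact: Cf|exact: l_lt].
have [u0 _ [y0 Fy0 _]] := below x Ox.
(* cells that miss [Fbox x] receive the arbitrary element [y0] of [Fbox x] *)
pose y (i : 'I_#|T|) :=
  xget y0 [set y | Fbox U f l C x y /\ c y = enum_val i].
have Fy i : Fbox U f l C x (y i).
  by rewrite /y; case: xgetP => [z _ []|].
have yc z : Fbox U f l C x z -> c (y (enum_rank (c z))) = c z.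
  move=> Fz; have [|_ ->] := @xgetPex _ y0
    [set y | Fbox U f l C x y /\ c y = enum_val (enum_rank (c z))].
    by exists z; rewrite enum_rankK.
  by rewrite enum_rankK.
apply/eps_wargminxP; exists y => //; split=> // -[x' [z [Ox' _ nz zy]]].
have [u Uu [w Fw wf]] := below x' Ox'.
pose i := enum_rank (c w).
have /not_beatenP/(_ u Uu)[j fz] := nz i.
have := cP _ _ (fun j => FM _ j (Fy i)) (fun j => FM _ j Fw) (yc w Fw) j.
have := zy i j; have := wf j; lra.
Qed.

End Cone.

End Problems.

(** * Robust efficiency through the finite problems *)

Theorem theorem4p8 (R : realType) (n k m : nat)
    (Omega : set 'rV[R]_n.+1) (U : set 'rV[R]_k.+1)
    (f : 'rV[R]_n.+1 * 'rV[R]_k.+1 -> 'rV[R]_m.+1)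
    (l : 'rV[R]_m.+1) (C : set 'rV[R]_m.+1)
    (Omega_neq0 : Omega !=set0) (Omega_closed : closed Omega)
    (U_neq0 : U !=set0) (U_closed : closed U) (U_compact : compact U)
    (f_cont : {within Omega `*` U, continuous f})
    (C_orthant : C `<=` interior orthant `|` [set 0])
    (C_closed : closed C) (C_cone : is_cone C) (C_convex : convex_set C)
    (C_pointed : pointed_cone C) (C_solid : solid C)
    (f_lower : f @` (Omega `*` U) `<=` set_add [set l] (interior C)) :
  (forall (eps : R) (p1 p2 : nat),
     0 <= eps -> (0 < p1)%N -> (0 < p2)%N -> (p1 <= p2)%N ->
     eps_wargminx_MP Omega U f l C eps p1 `<=`
     eps_wargminx_MP Omega U f l C eps p2) /\
  (\bigcup_(p in [set p : nat | (0 < p)%N]) wargminx_MP Omega U f l C p `<=`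
     wargmin_UP Omega U f /\
   wargmin_UP Omega U f =
     \bigcap_(eps in [set eps : R | 0 < eps])
       \bigcup_(p in [set p : nat | (0 < p)%N])
         eps_wargminx_MP Omega U f l C eps p) /\
  (bounded_set (f @` (wargmin_UP Omega U f `*` U)) ->
   forall eps : R, 0 < eps ->
   exists2 p : nat, (0 < p)%N &
     wargminx_MP Omega U f l C p `<=` wargmin_UP Omega U f /\
     wargmin_UP Omega U f `<=` eps_wargminx_MP Omega U f l C eps p).
Proof.
have f_int x u : Omega x -> U u -> interior C (f (x, u) - l).
  move=> Ox Uu.
  have [|_ -> [c Cc <-]] := f_lower (f (x, u)); first by exists (x, u).
  by rewrite addrC addKr.
have Cf x u : Omega x -> U u -> C (f (x, u) - l).
  by move=> Ox Uu; apply: interior_subset; exact: f_int.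
have l_lt x u : Omega x -> U u -> ltv l (f (x, u)).
  move=> Ox Uu j.
  have /interior_orthantP/(_ j) : interior orthant (f (x, u) - l).
    apply: interiorS (f_int x u Ox Uu) => c /C_orthant[/interior_subset//|->].
    by move=> i; rewrite mxE.
  by rewrite !mxE subr_gt0.
have cF x : Omega x -> compact (FU U f x).
  by move=> Ox; exact: FU_compact f_cont.
have not_robust x : Omega x -> ~ wargmin_UP Omega U f x ->
    exists2 e0, 0 < e0 & forall p eps, eps < e0 ->
      ~ eps_wargminx_MP Omega U f l C eps p x.
  move=> Ox nr.
  have [x' Ox' dom] : exists2 x', Omega x' & FU U f x' `<=` beaten U f x.
    apply: contrapT => nd; apply: nr; split => // -[x' Ox' dom].
    by apply: nd; exists x' => //; rewrite -set_sub_interior_orthant.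
  exact: (dominated_not_eps_efficient U_neq0 C_orthant C_cone l_lt C_closed
    (cF _ Ox') Ox Ox' dom).
have exact_robust p : wargminx_MP Omega U f l C p `<=` wargmin_UP Omega U f.
  move=> x xp; apply: contrapT => nr.
  have /eps_wargminxP[_ _ [Ox _]] := xp.
  have [e0 e00 ne] := not_robust x Ox nr.
  exact: ne xp.
have uniform (M : 'rV[R]_m.+1) eps : 0 < eps -> exists2 p, (0 < p)%N & forall x,
    wargmin_UP Omega U f x -> (forall j, ub U f x 0 j <= M 0 j) ->
    eps_wargminx_MP Omega U f l C eps p x.
  by move=> eps0; exact: robust_eps_efficient.
split; last split.
- by move=> eps p1 p2 _ p10 _ p12; exact: eps_wargminx_widen.
- split; first by move=> x [p _]; exact: exact_robust.
  apply/seteqP; split=> [x xr eps /= eps0|x xe].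
    have [p p0 H] := uniform (ub U f x) eps eps0.
    by exists p => //; apply: H.
  apply: contrapT => nr.
  (* any tolerance serves to see that [x] is admissible *)
  have [p _ /eps_wargminxP[_ _ [Ox _]]] := xe 1 ltr01.
  have [e0 e00 ne] := not_robust x Ox nr.
  have [|q _] := xe (e0 / 2); first by rewrite /= divr_gt0.
  by apply: ne; rewrite ltr_pdivrMr// ltr_pMr// ltr1n.
- move=> [b [_ fb]] eps eps0.
  (* one 1 because [b] bounds only through the larger constants, the other from
     the vector of ones in [ub] *)
  have [p p0 H] := uniform (const_mx (b + 1 + 1)) eps eps0.
  exists p => //; split; first exact: exact_robust.
  move=> x xr; apply: H => // j; rewrite !mxE lerD2r.
  apply: ge_sup; first by have [u Uu] := U_neq0; exists (f (x, u) 0 j), u.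
  move=> _ [u Uu <-]; apply: le_trans (ler_norm _) _.
  apply: le_trans (coord_le_norm _ _) _.
  by apply: fb; [rewrite ltrDl|exists (x, u)].
Qed.
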